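(* Let $0<p\leq 1$, let $A\in\mathbb{R}^{m\times N}$ with $N=nd$, and let $x\in\mathbb{R}^N$. Let $y=Ax+e$ with $\lVert e\rVert_2\leq\varepsilon$. Let $x^k$ be a best block $k$-sparse approximation of $x$ (i.e. $x^k$ minimizes $\lVert x-g\rVert_{2,1}$ over all block $k$-sparse $g\in\mathbb{R}^N$), and let $T_0\subset\{1,\dots,n\}$ be the block support of $x^k$. Let $\tilde T\subset\{1,\dots,n\}$ be an arbitrary set, and define $\rho,\alpha\geq 0$ by $|\tilde T|=\rho k$ and $|\tilde T\cap T_0|=\alpha\rho k$. Let $0\leq\omega\leq 1$ and set $\gamma=\omega+(1-\omega)(1+\rho-2\alpha\rho)^{1-p/2}$. Suppose there exists an integer $a$ with $a\geq(1-\alpha)\rho$ and $a>1$ such that $$\delta_{ak}+\frac{a^{1-p/2}}{\gamma}\delta_{(a+1)k}<\frac{a^{1-p/2}}{\gamma}-1 .$$ Then any solution $x^\sharp$ of $$\min_{z\in\mathbb{R}^N}\sum_{i=1}^n w_i\lVert z[i]\rVert_2^p\quad\text{subject to}\quad \lVert y-Az\rVert_2\leq\varepsilon,\qquad w_i=\begin{cases}\omega,& i\in\tilde T\\ 1,& i\in\tilde T^c\end{cases}$$ satisfies $$\lVert x^\sharp-x\rVert_2\leq C_1\frac{\Big(\omega\lVert x-x^k\rVert_{2,p}^p+(1-\omega)\lVert x_{\tilde T^c\cap T_0^c}\rVert_{2,p}^p\Big)^{1/p}}{k^{1/p-1/2}}+C_2\varepsilon$$ for some positive constants $C_1,C_2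$.
   Context: Vectors $x\in\mathbb{R}^N$, $N=nd$, are split into $n$ consecutive blocks of length $d$: $x[i]=(x_{(i-1)d+1},\dots,x_{id})^T$, $i=1,\dots,n$. For $p>0$, $\lVert x\rVert_{2,p}=(\sum_{i=1}^n\lVert x[i]\rVert_2^p)^{1/p}$. A vector is block $k$-sparse if at most $k$ blocks $x[i]$ are nonzero; its block support is the set of indices $i$ with $x[i]\neq 0$. For a block index set $T$, $x_T$ denotes the vector equal to $x$ on the blocks indexed by $T$ and zero elsewhere; $T^c$ is the complement in $\{1,\dots,n\}$. For a vector $v\in\mathbb{R}^m$, $\lVert v\rVert_p^p=\sum_{i=1}^m|v_i|^p$. The block $p$-restricted isometry constant $\delta_k$ of $A$ (of order $k$) is the smallest positive number such that $(1-\delta_k)\lVert z\rVert_2^p\leq\lVert Az\rVert_p^p\leq(1+\delta_k)\lVert z\rVert_2^p$ for all block $k$-sparse $z\in\mathbb{R}^N$. *)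

(* Defs.v *)
From HB Require Import structures.
From mathcomp Require Import all_boot all_order all_algebra.
From mathcomp Require Import boolp classical_sets reals exp.
Set Implicit Arguments. Unset Strict Implicit. Unset Printing Implicit Defensive.
Import Order.TTheory GRing.Theory Num.Theory.
Local Open Scope ring_scope.

Section BlockDefs.
Variable R : realType.
Variables n d : nat.

Lemma bidx_proof (i : 'I_n) (j : 'I_d) : (i * d + j < n * d)%N.
Proof.
case: i j => i hi [j hj] /=.
apply: (@leq_trans (i * d + d)); first by rewrite ltn_add2l.
by rewrite -mulSnr leq_mul2r hi orbT.
Qed.
Definition bidx (i : 'I_n) (j : 'I_d) : 'I_(n * d) := Ordinal (bidx_proof i j).

Lemma blockof_proof (l : 'I_(n * d)) : (l %/ d < n)%N.
Proof.
case: l => l hl /=.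
have d0 : (0 < d)%N.
  by case: d hl => // ; rewrite muln0.
by rewrite ltn_divLR.
Qed.
Definition blockof (l : 'I_(n * d)) : 'I_n := Ordinal (blockof_proof l).

Definition blk (x : 'cV[R]_(n * d)) (i : 'I_n) : 'I_d -> R :=
  fun j => x (bidx i j) 0.

Definition norm2 m (v : 'cV[R]_m) : R := Num.sqrt (\sum_i (v i 0) ^+ 2).

Definition bnorm2 (x : 'cV[R]_(n * d)) (i : 'I_n) : R :=
  Num.sqrt (\sum_j (blk x i j) ^+ 2).

Definition normp_pow m (p : R) (v : 'cV[R]_m) : R := \sum_i `|v i 0| `^ p.

Definition mixnorm_pow (p : R) (x : 'cV[R]_(n * d)) : R :=
  \sum_i bnorm2 x i `^ p.

Definition mixnorm (p : R) (x : 'cV[R]_(n * d)) : R := mixnorm_pow p x `^ p^-1.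

Definition bsupp (x : 'cV[R]_(n * d)) : {set 'I_n} :=
  [set i | [exists j, blk x i j != 0]].
Definition bsparse (k : nat) (x : 'cV[R]_(n * d)) : Prop := (#|bsupp x| <= k)%N.

Definition restrict (x : 'cV[R]_(n * d)) (T : {set 'I_n}) : 'cV[R]_(n * d) :=
  \col_l (if blockof l \in T then x l 0 else 0).

Definition ripc m (p : R) (A : 'M[R]_(m, n * d)) (k : nat) : R :=
  inf [set dl : R | 0 < dl /\
         forall z : 'cV[R]_(n * d), bsparse k z ->
           (1 - dl) * norm2 z `^ p <= normp_pow p (A *m z) /\
           normp_pow p (A *m z) <= (1 + dl) * norm2 z `^ p].

Definition best_block_approx (k : nat) (x xk : 'cV[R]_(n * d)) : Prop :=
  bsparse k xk /\
  forall g, bsparse k g -> mixnorm 1 (x - xk) <= mixnorm 1 (x - g).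

Definition wobj (p om : R) (Tt : {set 'I_n}) (z : 'cV[R]_(n * d)) : R :=
  \sum_i (if i \in Tt then om else 1) * bnorm2 z i `^ p.

Definition is_wlp_solution m (p om : R) (Tt : {set 'I_n})
    (A : 'M[R]_(m, n * d)) (y : 'cV[R]_m) (eps : R) (xs : 'cV[R]_(n * d)) : Prop :=
  norm2 (y - A *m xs) <= eps /\
  forall z, norm2 (y - A *m z) <= eps -> wobj p om Tt xs <= wobj p om Tt z.

End BlockDefs.

(* Main.v *)
Require Import Defs.
From HB Require Import structures.
From mathcomp Require Import all_boot all_order all_algebra.
From mathcomp Require Import boolp classical_sets reals exp.
From mathcomp Require Import zify ring lra.
Import Order.TTheory GRing.Theory Num.Theory.
Local Open Scope ring_scope.

(* Put h = x# - x, let T0 be the block support of x^k, let T1 consist of the ak largest blocks of h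
   off T0, and let E be the expression raised to the power 1/p in the error bound. Optimality of x#
   gives the cone inequality
     ||h_{T0^c}||^p <= om ||h_{T0}||^p + (1 - om) ||h_{T0 symdiff T~}||^p + 2 E
   in the (2,p)-quasinorm. As |T~ \ T0| <= ak, both T0 and the symmetric difference carry at most
   the l2-mass of h on T0 u T1, so by Hoelder the right-hand side is at most
   gamma k^(1-p/2) ||h_{T0 u T1}||_2^p + 2 E. Cutting the rest of h into layers of decreasing blocks
   bounds its contribution by V = (ak)^(p/2-1) ||h_{T0^c}||^p, and the restricted isometry property
   gives (1 - delta_{(a+1)k}) ||h_{T0 u T1}||_2^p <= ||A h||_p^p + (1 + delta_{ak}) V. The
   hypothesis on the constants absorbs the resulting multiple of ||h_{T0 u T1}||_2^p on the left. *)

(** * Inequalities for real powers with exponent at most one *)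

Lemma le_powR (R : realType) (r x y : R) :
  0 <= r -> 0 <= x -> x <= y -> x `^ r <= y `^ r.
Proof.
move=> r0 x0 xy; apply: ge0_ler_powR => //; rewrite nnegrE //.
exact: le_trans xy.
Qed.

Lemma powRD_gt0 (R : realType) (x r s : R) : 0 < x -> x `^ (r + s) = x `^ r * x `^ s.
Proof. by move=> x0; rewrite powRD // (gt_eqF x0) implybT. Qed.

(** Each ratio t = u / (x + y), for u = x or u = y, lies in [0, 1], so t <= t^s. Multiplying by (x +
    y)^s and adding the two inequalities gives the claim. *)
Lemma powR_addl_le (R : realType) (s x y : R) : 0 < s -> s <= 1 -> 0 <= x -> 0 <= y ->
  (x + y) `^ s <= x `^ s + y `^ s.
Proof.
move=> s0 s1 x0 y0.
have [->|xn0] := eqVneq x 0; first by rewrite add0r powR0 ?add0r // gt_eqF.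
have xy0 : 0 < x + y by rewrite ltr_pwDl // lt0r xn0.
have part (u : R) : 0 <= u -> u <= x + y -> (x + y) `^ s * (u / (x + y)) <= u `^ s.
  move=> u0 uxy; have [->|un0] := eqVneq u 0; first by rewrite mul0r mulr0 powR_ge0.
  have up : 0 < u by rewrite lt0r un0.
  rewrite -[in leRHS](divfK (lt0r_neq0 xy0) u).
  rewrite powRM ?(ltW xy0) ?divr_ge0 ?(ltW xy0) // mulrC ler_wpM2r ?powR_ge0 //.
  by rewrite ger1_powR // divr_gt0 //= ler_pdivrMr // mul1r.
have := lerD (part x x0 ltac:(lra)) (part y y0 ltac:(lra)).
by rewrite -mulrDr -mulrDl divff ?gt_eqF // mulr1.
Qed.

(* The tangent line of the concave map [t `^ s] at [t = 1]. *)
Lemma powR_le_tangent (R : realType) (s t : R) : 0 < s -> s < 1 -> 0 <= t ->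
  t `^ s <= 1 - s + s * t.
Proof.
move=> s0 s1 t0.
(* Young's inequality for the product of t^s and 1, with exponents 1/s and 1/(1-s). *)
have := @conjugate_powR R (t `^ s) 1 s^-1 (1 - s)^-1.
rewrite powR_ge0 ler01 !invr_gt0 subr_gt0 s0 s1 !invrK subrKC -powRrM.
rewrite mulfV ?gt_eqF // powRr1 // powR1 mulr1 mul1r.
by move=> /(_ isT isT isT isT erefl); lra.
Qed.

(** Jensen's inequality: the tangent bound is applied to F i / mu, where mu is the mean of F over X,
    and the tangent values sum to #|X|. *)
Lemma sum_powR_le (R : realType) (I : finType) (X : {set I}) (F : I -> R) (s : R) :
  0 < s -> s < 1 -> (forall i, 0 <= F i) ->
  \sum_(i in X) F i `^ s <= #|X|%:R `^ (1 - s) * (\sum_(i in X) F i) `^ s.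
Proof.
move=> s0 s1 F0; set S := \sum_(i in X) F i.
have S0 : 0 <= S by apply: sumr_ge0.
have sn0 : s != 0 by rewrite gt_eqF.
have [Sz|Sn0] := eqVneq S 0.
  rewrite big1 ?mulr_ge0 ?powR_ge0 // => i iX.
  suff -> : F i = 0 by rewrite powR0.
  by move/psumr_eq0P: Sz => ->.
have X0 : (0 < #|X|)%N.
  rewrite lt0n; apply: contra_neq Sn0 => /eqP; rewrite cards_eq0 => /eqP X0.
  by rewrite /S X0 big_set0.
have Xr : 0 < #|X|%:R :> R by rewrite ltr0n.
set mu := S / #|X|%:R.
have mu0 : 0 < mu by rewrite divr_gt0 // lt0r Sn0.
have -> : #|X|%:R `^ (1 - s) * S `^ s = #|X|%:R * mu `^ s.
  have -> : S = #|X|%:R * mu by rewrite mulrC divfK ?gt_eqF.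
  rewrite powRM ?(ltW mu0) ?ler0n // mulrA -powRD_gt0 //.
  by rewrite subrK powRr1 ?ler0n.
have -> : #|X|%:R * mu `^ s = \sum_(i in X) mu `^ s * (1 - s + s * (F i / mu)).
  rewrite -mulr_sumr big_split /= -mulr_sumr -mulr_suml -/S.
  rewrite sumr_const -mulr_natl mulrC; congr (_ * _).
  have -> : S / mu = #|X|%:R by rewrite /mu; field; rewrite Sn0 gt_eqF.
  ring.
apply: ler_sum => i _.
rewrite -{1}(divfK (lt0r_neq0 mu0) (F i)) powRM ?(ltW mu0) ?divr_ge0 ?(ltW mu0) //.
by rewrite mulrC ler_wpM2l ?powR_ge0 // powR_le_tangent ?divr_ge0 ?(ltW mu0).
Qed.

(** * Cauchy-Schwarz and Minkowski inequalities for finite families *)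

Section EuclideanNorm.
Variables (R : realType) (I : finType).
Implicit Types f g : I -> R.

(** With u and v the norms of f and g, the nonnegative sum of (v f i - u g i)^2 equals 2uv(uv - S).
    Vanishing norms are treated first, so that uv can be cancelled. *)
Lemma sum_mul_le_sqrt f g :
  \sum_i f i * g i <= Num.sqrt (\sum_i f i ^+ 2) * Num.sqrt (\sum_i g i ^+ 2).
Proof.
set F := \sum_i f i ^+ 2; set G := \sum_i g i ^+ 2; set S := \sum_i _.
have F0 : 0 <= F by apply: sumr_ge0 => i _; exact: sqr_ge0.
have G0 : 0 <= G by apply: sumr_ge0 => i _; exact: sqr_ge0.
set u := Num.sqrt F; set v := Num.sqrt G.
have u2 : u ^+ 2 = F by rewrite sqr_sqrtr.
have v2 : v ^+ 2 = G by rewrite sqr_sqrtr.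
have [Fz|Fn0] := eqVneq F 0.
  rewrite /S big1 ?mulr_ge0 ?sqrtr_ge0 // => i _.
  move/psumr_eq0P: Fz => /(_ (fun i _ => sqr_ge0 _) i isT) /eqP.
  by rewrite sqrf_eq0 => /eqP ->; rewrite mul0r.
have [Gz|Gn0] := eqVneq G 0.
  rewrite /S big1 ?mulr_ge0 ?sqrtr_ge0 // => i _.
  move/psumr_eq0P: Gz => /(_ (fun i _ => sqr_ge0 _) i isT) /eqP.
  by rewrite sqrf_eq0 => /eqP ->; rewrite mulr0.
have uv0 : 0 < u * v by rewrite mulr_gt0 // sqrtr_gt0 lt0r ?Fn0 ?Gn0.
have : 0 <= \sum_i (v * f i - u * g i) ^+ 2 by apply: sumr_ge0 => i _; exact: sqr_ge0.
have -> : \sum_i (v * f i - u * g i) ^+ 2 = 2 * (u * v) * (u * v - S).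
  transitivity (v ^+ 2 * F - 2 * (u * v) * S + u ^+ 2 * G).
    rewrite !mulr_sumr -sumrB -big_split /=; apply: eq_bigr => i _; ring.
  by rewrite -u2 -v2; ring.
by rewrite pmulr_rge0 ?subr_ge0 // mulr_gt0.
Qed.

Lemma sqrt_sumsqD f g :
  Num.sqrt (\sum_i (f i + g i) ^+ 2) <=
  Num.sqrt (\sum_i f i ^+ 2) + Num.sqrt (\sum_i g i ^+ 2).
Proof.
have s0 h : 0 <= \sum_i h i ^+ 2 :> R by apply: sumr_ge0 => i _; exact: sqr_ge0.
rewrite -ler_sqr ?nnegrE ?addr_ge0 ?sqrtr_ge0 // sqrrD !sqr_sqrtr ?s0 //.
have -> : \sum_i (f i + g i) ^+ 2 =
  \sum_i f i ^+ 2 + (\sum_i f i * g i) *+ 2 + \sum_i g i ^+ 2.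
  rewrite -sumrMnl -!big_split /=; apply: eq_bigr => i _; exact: sqrrD.
by rewrite lerD2r lerD2l lerMn2r sum_mul_le_sqrt orbT.
Qed.

Lemma abs_le_sqrt_sumsq f i : `|f i| <= Num.sqrt (\sum_i f i ^+ 2).
Proof.
rewrite -sqrtr_sqr; apply: ler_wsqrtr.
by rewrite (bigD1 i) //= lerDl sumr_ge0 // => j _; exact: sqr_ge0.
Qed.

End EuclideanNorm.

(** * Passing between squared norms and p-th powers *)

Lemma sqr_powR_half (R : realType) (p x : R) : 0 <= x -> (x ^+ 2) `^ (p / 2) = x `^ p.
Proof. by move=> x0; rewrite -powR_mulrn // -powRrM [2 * _]mulrC divfK ?pnatr_eq0. Qed.

(** The sum is at most twice the larger term. This serves the exponent 1/p >= 1, for which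
    subadditivity may fail. *)
Lemma powRD_le_mul2 (R : realType) (r x y : R) : 0 <= r -> 0 <= x -> 0 <= y ->
  (x + y) `^ r <= 2 `^ r * (x `^ r + y `^ r).
Proof.
move=> r0; wlog xy : x y / x <= y => [H x0 y0|x0 y0].
  by have [/H|/ltW/H] := leP x y; [exact|rewrite addrC [_ `^ r + _]addrC; exact].
apply: (@le_trans _ _ ((2 * y) `^ r)); first by apply: le_powR; rewrite ?addr_ge0 //; lra.
by rewrite powRM // ler_wpM2l ?powR_ge0 // lerDr powR_ge0.
Qed.

(** Jensen with exponent p/2, applied to the squares. N is a real upper bound on the cardinality, so
    that it can be taken of the form sigma k. *)
Lemma sum_bnorm2_powR_le (R : realType) (I : finType) (b : I -> R) (p N B : R) (X : {set I}) :
  0 < p -> p <= 1 -> (forall i, 0 <= b i) ->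
  #|X|%:R <= N -> \sum_(i in X) b i ^+ 2 <= B ->
  \sum_(i in X) b i `^ p <= N `^ (1 - p / 2) * B `^ (p / 2).
Proof.
move=> p0 p1 b0 XN XB.
rewrite (eq_bigr (fun i => (b i ^+ 2) `^ (p / 2))); last by move=> i _; rewrite sqr_powR_half.
apply: (le_trans (sum_powR_le _ _ _ _ _ _ _ _)); [lra|lra|by move=> i; exact: sqr_ge0|].
apply: ler_pM; rewrite ?powR_ge0 //; apply: le_powR => //; first lra; first lra.
by apply: sumr_ge0 => i _; exact: sqr_ge0.
Qed.

Lemma sum_setU_disjoint (R : realType) (I : finType) (X Y : {set I}) (F : I -> R) :
  [disjoint X & Y] ->
  \sum_(i in X :|: Y) F i = \sum_(i in X) F i + \sum_(i in Y) F i.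
Proof.
by move=> XY; rewrite -bigU //=; apply: eq_bigl => i; rewrite finset.inE.
Qed.

(** * Largest entries and decomposition into decreasing layers *)

Section LargestEntries.
Variables (R : realType) (I : finType) (b : I -> R).
Hypothesis b0 : forall i, 0 <= b i.
Implicit Types S T X : {set I}.

Definition dominates T X := forall i j, i \in T -> j \in X -> b j <= b i.

(** Greedy choice: each step adds a maximizer of b among the remaining elements. *)
Lemma exists_dominating_subset S (q : nat) : (q <= #|S|)%N ->
  exists T, [/\ T \subset S, #|T| = q & dominates T (S :\: T)].
Proof.
elim: q => [_|q IH qS].
  by exists finset.set0; rewrite finset.sub0set cards0; split=> // i j; rewrite finset.inE.
have [T [TS Tq Tdom]] := IH (ltnW qS).
have [i0 i0S] : exists i, i \in S :\: T.
  by apply/card_gt0P; rewrite cardsDS // Tq subn_gt0.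
case: (Order.TotalTheory.arg_maxP b i0S) => i iS imax.
move: (iS : i \in S :\: T); rewrite finset.inE => /andP[iT iS'].
exists (i |: T); split.
- by rewrite finset.subUset finset.sub1set iS' TS.
- by rewrite cardsU1 iT Tq.
- move=> u v; rewrite !finset.inE negb_or -andbA => /predU1P[->|uT] /and3P[vi vT vS].
    have vST : v \in S :\: T by rewrite finset.inE vT vS.
    exact: imax.
  by apply: Tdom => //; rewrite finset.inE vT vS.
Qed.

(** The largest entry of X is a threshold separating X from T. *)
Lemma max_dominated X T : X != finset.set0 -> dominates T X ->
  exists2 i, forall j, j \in X -> b j <= b i & forall j, j \in T -> b i <= b j.
Proof.
move=> /finset.set0Pn[i0 i0X] dom.
case: (Order.TotalTheory.arg_maxP b i0X) => i iX imax.
by exists i => [j|j jT]; [exact: imax|exact: dom].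
Qed.

Lemma sum_sqr_dominated X T : (#|X| <= #|T|)%N -> dominates T X ->
  \sum_(i in X) b i ^+ 2 <= \sum_(i in T) b i ^+ 2.
Proof.
move=> XT dom; have [->|Xn0] := eqVneq X finset.set0.
  by rewrite big_set0 sumr_ge0 // => i _; exact: sqr_ge0.
have [i0 Xi0 Ti0] := max_dominated _ _ Xn0 dom.
apply: (@le_trans _ _ (#|X|%:R * b i0 ^+ 2)).
  rewrite mulr_natl -sumr_const; apply: ler_sum => i iX.
  by rewrite lerXn2r ?nnegrE // Xi0.
apply: (@le_trans _ _ (#|T|%:R * b i0 ^+ 2)).
  by rewrite ler_wpM2r ?sqr_ge0 // ler_nat.
rewrite mulr_natl -sumr_const; apply: ler_sum => i iX.
by rewrite lerXn2r ?nnegrE // Ti0.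
Qed.

(** The common part of X and T cancels. What is left of X has no more elements than what is left of
    T, and is dominated by it. *)
Lemma sum_sqr_top S T X : T \subset S -> dominates T (S :\: T) ->
  X \subset S -> (#|X| <= #|T|)%N ->
  \sum_(i in X) b i ^+ 2 <= \sum_(i in T) b i ^+ 2.
Proof.
move=> TS dom XS XT.
rewrite (big_setID T) [leRHS](big_setID X) /= finset.setIC lerD2l.
apply: sum_sqr_dominated; first by rewrite -(leq_add2l #|X :&: T|) cardsID finset.setIC cardsID.
move=> i j; rewrite !finset.inE => /andP[_ iT] /andP[jT jX].
by apply: dom => //; rewrite finset.inE jT (fintype.subsetP XS).
Qed.

(** Let t be the largest entry of X and q = #|T|. The left side is at most (q t^2)^(p/2) = q^(p/2-1)
    q t^p, and every entry of T is at least t. *)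
Lemma sum_sqr_powR_dominated (p : R) X T : 0 < p -> (0 < #|T|)%N ->
  (#|X| <= #|T|)%N -> dominates T X ->
  (\sum_(i in X) b i ^+ 2) `^ (p / 2) <=
  #|T|%:R `^ (p / 2 - 1) * \sum_(i in T) b i `^ p.
Proof.
move=> p0 T0 XT dom; have p2 : 0 < p / 2 by rewrite divr_gt0.
have rhs0 : 0 <= #|T|%:R `^ (p / 2 - 1) * \sum_(i in T) b i `^ p.
  by rewrite mulr_ge0 ?powR_ge0 // sumr_ge0 // => i _; exact: powR_ge0.
have [->|Xn0] := eqVneq X finset.set0; first by rewrite big_set0 powR0 ?gt_eqF.
have [i0 Xi0 Ti0] := max_dominated _ _ Xn0 dom.
apply: (@le_trans _ _ ((#|T|%:R * b i0 ^+ 2) `^ (p / 2))).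
  apply: le_powR; rewrite ?(ltW p2) //; first by apply: sumr_ge0 => i _; exact: sqr_ge0.
  apply: (@le_trans _ _ (#|X|%:R * b i0 ^+ 2)).
    rewrite mulr_natl -sumr_const; apply: ler_sum => i iX.
    by rewrite lerXn2r ?nnegrE // Xi0.
  by rewrite ler_wpM2r ?sqr_ge0 // ler_nat.
have -> : (#|T|%:R * b i0 ^+ 2) `^ (p / 2) =
    #|T|%:R `^ (p / 2 - 1) * (#|T|%:R * b i0 `^ p).
  rewrite powRM ?ler0n ?sqr_ge0 // sqr_powR_half // mulrA; congr (_ * _).
  by rewrite -[X in _ = _ * X]powRr1 ?ler0n // -powRD_gt0 ?subrK ?ltr0n.
rewrite ler_wpM2l ?powR_ge0 // mulr_natl -sumr_const; apply: ler_sum => i iT.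
by apply: le_powR; rewrite ?(ltW p0) // Ti0.
Qed.

(* [F] plays both the roles of [X => ||h_X||_2^p] and [X => ||A h_X||_p^p]. The induction peels off
   [S] its [q] largest entries, each layer being bounded by the previous one. *)
Lemma subadditive_tail_le (p C : R) (q : nat) (F : {set I} -> R) :
  0 < p -> (0 < q)%N -> 0 <= C ->
  (forall S T, T \subset S -> F S <= F T + F (S :\: T)) ->
  (forall X, (#|X| <= q)%N -> F X <= C * (\sum_(i in X) b i ^+ 2) `^ (p / 2)) ->
  forall S T, T \subset S -> #|T| = q -> dominates T (S :\: T) ->
  F (S :\: T) <= C * (q%:R `^ (p / 2 - 1) * \sum_(i in S) b i `^ p).
Proof.
move=> p0 q0 C0 Fsub Fle S; have [N] := ubnP #|S|.
elim: N S => // N IH S SN T TS Tq dom.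
have Spos X : 0 <= \sum_(i in X) b i `^ p by apply: sumr_ge0 => i _; exact: powR_ge0.
have step X : (#|X| <= q)%N -> X \subset S :\: T ->
    F X <= C * (q%:R `^ (p / 2 - 1) * \sum_(i in T) b i `^ p).
  move=> Xq XS; apply: le_trans (Fle X Xq) _; rewrite ler_wpM2l // -Tq.
  apply: sum_sqr_powR_dominated; rewrite ?Tq // => i j iT /(fintype.subsetP XS).
  exact: dom.
rewrite [X in _ <= C * (_ * X)](big_setID T) /= (finset.setIidPr TS) !mulrDr.
have [small|/ltnW big] := leqP #|S :\: T| q.
  apply: le_trans (step _ small (subxx _)) _.
  by rewrite lerDl !mulr_ge0 ?powR_ge0.
have [T' [T'S T'q dom']] := exists_dominating_subset _ _ big.
apply: le_trans (Fsub _ _ T'S) _; apply: lerD.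
  by apply: step; rewrite ?T'q.
have qS : (q <= #|S|)%N by rewrite -Tq subset_leq_card.
apply: IH => //; rewrite ltnS in SN; apply: leq_trans SN.
by rewrite cardsDS // Tq ltn_subrL q0 (leq_trans q0).
Qed.

(** F is quantified after T, so that one set T serves several functionals. If S has at most q
    elements then T = S, and F is at most 0 on the empty tail because 0^(p/2) = 0. *)
Lemma exists_top_with_tail (p : R) (q : nat) S : 0 < p -> (0 < q)%N ->
  exists T, [/\ T \subset S, (#|T| <= q)%N,
    forall X, X \subset S -> (#|X| <= q)%N ->
      \sum_(i in X) b i ^+ 2 <= \sum_(i in T) b i ^+ 2
  & forall (F : {set I} -> R) (C : R), 0 <= C ->
      (forall S T, T \subset S -> F S <= F T + F (S :\: T)) ->
      (forall X, (#|X| <= q)%N -> F X <= C * (\sum_(i in X) b i ^+ 2) `^ (p / 2)) ->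
      F (S :\: T) <= C * (q%:R `^ (p / 2 - 1) * \sum_(i in S) b i `^ p)].
Proof.
move=> p0 q0; have [small|/ltnW big] := leqP #|S| q.
  exists S; split=> // [X XS _|F C C0 _ Fle].
    rewrite [leRHS](big_setID X) /= (finset.setIidPr XS) lerDl sumr_ge0 // => i _.
    exact: sqr_ge0.
  have p2 : p / 2 != 0 by rewrite gt_eqF // divr_gt0.
  rewrite finset.setDv; apply: (le_trans (Fle _ _)); rewrite ?cards0 // big_set0 powR0 //.
  rewrite mulr0 !mulr_ge0 ?powR_ge0 // sumr_ge0 // => i _; exact: powR_ge0.
have [T [TS Tq dom]] := exists_dominating_subset _ _ big.
exists T; split=> // [|X XS Xq|F C C0 Fsub Fle]; first by rewrite Tq.
  by apply: (sum_sqr_top S); rewrite ?Tq.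
exact: subadditive_tail_le.
Qed.

End LargestEntries.

(** * Block norms and restriction to block index sets *)

Section Blocks.
Variables (R : realType) (n d : nat).
Implicit Types (x h : 'cV[R]_(n * d)) (S T : {set 'I_n}) (i : 'I_n) (j : 'I_d).

Lemma blockof_bidx i j : blockof (bidx i j) = i.
Proof.
apply: val_inj => /=; have d0 : (0 < d)%N := leq_ltn_trans (leq0n j) (ltn_ord j).
by rewrite divnMDl // divn_small // addn0.
Qed.

(** [bidx] is injective, since [blockof] recovers the block, and both index sets have n d elements;
    hence it is a bijection. *)
Lemma sum_bidx (F : 'I_(n * d) -> R) : \sum_l F l = \sum_i \sum_j F (bidx i j).
Proof.
rewrite pair_big /= (reindex (fun u : 'I_n * 'I_d => bidx u.1 u.2)) //=.
apply: onW_bij; apply: inj_card_bij; last by rewrite card_prod !card_ord.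
move=> [i j] [i' j'] /= e.
have ii : i = i' by rewrite -(blockof_bidx i j) e blockof_bidx.
congr (_, _) => //; apply: val_inj => /=.
by move: e => /(congr1 val) /=; rewrite ii => /addnI.
Qed.

Lemma bnorm2_ge0 x i : 0 <= bnorm2 x i.
Proof. exact: sqrtr_ge0. Qed.

Lemma norm2_ge0 (m : nat) (v : 'cV[R]_m) : 0 <= norm2 v.
Proof. exact: sqrtr_ge0. Qed.

Lemma bnorm2_sqr x i : bnorm2 x i ^+ 2 = \sum_j blk x i j ^+ 2.
Proof. by rewrite sqr_sqrtr // sumr_ge0 // => j _; exact: sqr_ge0. Qed.

Lemma bnorm2N x i : bnorm2 (- x) i = bnorm2 x i.
Proof. by congr Num.sqrt; apply: eq_bigr => j _; rewrite /blk mxE sqrrN. Qed.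

Lemma bnorm2D x h i : bnorm2 (x + h) i <= bnorm2 x i + bnorm2 h i.
Proof.
rewrite /bnorm2 (eq_bigr (fun j => (blk x i j + blk h i j) ^+ 2)); first exact: sqrt_sumsqD.
by move=> j _; rewrite /blk mxE.
Qed.

Lemma powR_bnorm2D (p : R) x h i : 0 < p -> p <= 1 ->
  bnorm2 (x + h) i `^ p <= bnorm2 x i `^ p + bnorm2 h i `^ p.
Proof.
move=> p0 p1; apply: le_trans (powR_addl_le _ _ _ _ p0 p1 _ _); rewrite ?bnorm2_ge0 //.
by apply: le_powR; rewrite ?bnorm2_ge0 ?bnorm2D // ltW.
Qed.

Lemma norm2_sqr x : norm2 x ^+ 2 = \sum_i bnorm2 x i ^+ 2.
Proof.
rewrite sqr_sqrtr; last by apply: sumr_ge0 => l _; exact: sqr_ge0.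
rewrite sum_bidx; by apply: eq_bigr => i _; rewrite bnorm2_sqr.
Qed.

Lemma blk_restrict x T i j : blk (restrict x T) i j = if i \in T then blk x i j else 0.
Proof. by rewrite /blk mxE blockof_bidx. Qed.

Lemma bnorm2_restrict x T i :
  bnorm2 (restrict x T) i = if i \in T then bnorm2 x i else 0.
Proof.
rewrite /bnorm2; case: ifP => iT.
  by congr Num.sqrt; apply: eq_bigr => j _; rewrite blk_restrict iT.
by rewrite big1 ?sqrtr0 // => j _; rewrite blk_restrict iT expr0n.
Qed.

Lemma norm2_restrict_powR (p : R) x T :
  norm2 (restrict x T) `^ p = (\sum_(i in T) bnorm2 x i ^+ 2) `^ (p / 2).
Proof.
rewrite -sqr_powR_half ?norm2_ge0 // norm2_sqr [in RHS]big_mkcond /=.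
congr (_ `^ _); apply: eq_bigr => i _; rewrite bnorm2_restrict.
by case: ifP => // _; rewrite expr0n.
Qed.

Lemma mixnorm_pow_restrict (p : R) x T : p != 0 ->
  mixnorm_pow p (restrict x T) = \sum_(i in T) bnorm2 x i `^ p.
Proof.
move=> p0; rewrite /mixnorm_pow [in RHS]big_mkcond /=.
by apply: eq_bigr => i _; rewrite bnorm2_restrict; case: ifP => // _; rewrite powR0.
Qed.

Lemma bsparse_restrict (k : nat) x T : (#|T| <= k)%N -> bsparse k (restrict x T).
Proof.
apply: leq_trans; apply/subset_leq_card/fintype.subsetP => i.
rewrite finset.inE => /existsP[j]; rewrite blk_restrict.
by case: ifP => // _; rewrite eqxx.
Qed.

Lemma restrict_setT x : restrict x [set: 'I_n]%SET = x.
Proof. by apply/colP => l; rewrite mxE finset.in_setT. Qed.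

Lemma restrict_setID x S T : T \subset S ->
  restrict x S = restrict x T + restrict x (S :\: T).
Proof.
move=> /fintype.subsetP TS; apply/colP => l; rewrite !mxE finset.in_setD.
case: (boolP (_ \in T)) => [lT|_] /=; first by rewrite TS // addr0.
by rewrite add0r.
Qed.

(** Subtracting [xk] leaves the blocks off its support unchanged; the other blocks contribute
    nonnegative terms. *)
Lemma mixnorm_pow_sub_ge (p : R) x xk :
  \sum_(i in ~: bsupp xk) bnorm2 x i `^ p <= mixnorm_pow p (x - xk).
Proof.
rewrite /mixnorm_pow [leRHS](bigID (fun i => i \in bsupp xk)) /= ler_wpDl //.
  by apply: sumr_ge0 => i _; exact: powR_ge0.
rewrite (eq_bigl (fun i => i \notin bsupp xk)); last by move=> i; rewrite finset.in_setC.
apply: ler_sum => i ixk; rewrite le_eqVlt; apply/orP; left; apply/eqP.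
congr (_ `^ _); congr Num.sqrt.
apply: eq_bigr => j _; rewrite /blk !mxE.
move: ixk; rewrite finset.inE => /existsPn /(_ j) /negPn/eqP.
by rewrite /blk => ->; rewrite subr0.
Qed.

End Blocks.

(** * The restricted isometry constant as an attained infimum *)

Section RestrictedIsometry.
Variables (R : realType) (m n d : nat) (p : R) (A : 'M[R]_(m, n * d)).
Hypotheses (p0 : 0 < p) (p1 : p <= 1).

Lemma normp_powD (u v : 'cV[R]_m) : normp_pow p (u + v) <= normp_pow p u + normp_pow p v.
Proof.
rewrite /normp_pow -big_split /=; apply: ler_sum => i _; rewrite mxE.
apply: le_trans (powR_addl_le _ _ _ _ p0 p1 _ _) => //.
by apply: le_powR; rewrite ?(ltW p0) // ler_normD.
Qed.

Lemma normp_powN (u : 'cV[R]_m) : normp_pow p (- u) = normp_pow p u.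
Proof. by apply: eq_bigr => i _; rewrite mxE normrN. Qed.

Lemma normp_pow_ge0 (u : 'cV[R]_m) : 0 <= normp_pow p u.
Proof. by apply: sumr_ge0 => i _; exact: powR_ge0. Qed.

(** A crude operator bound, meant to show that the set defining [ripc] is nonempty. *)
Lemma normp_pow_mulmx_le (z : 'cV[R]_(n * d)) :
  normp_pow p (A *m z) <= (\sum_i (\sum_l `|A i l|) `^ p) * norm2 z `^ p.
Proof.
rewrite mulr_suml; apply: ler_sum => i _.
have sA : 0 <= \sum_l `|A i l| by apply: sumr_ge0.
rewrite -powRM ?norm2_ge0 //; apply: le_powR; rewrite ?(ltW p0) // mxE.
apply: le_trans (ler_norm_sum _ _ _) _; rewrite mulr_suml; apply: ler_sum => l _.
by rewrite normrM ler_wpM2l // (abs_le_sqrt_sumsq _ _ (fun l => z l 0)).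
Qed.

Let RIP (k : nat) : set R := [set dl : R | 0 < dl /\
         forall z : 'cV[R]_(n * d), bsparse k z ->
           (1 - dl) * norm2 z `^ p <= normp_pow p (A *m z) /\
           normp_pow p (A *m z) <= (1 + dl) * norm2 z `^ p]%classic.

(** With C the crude operator bound, 1 + C is admissible: its lower inequality is trivial because 1
    - (1 + C) <= 0. *)
Lemma has_inf_RIP (k : nat) : has_inf (RIP k).
Proof.
split; last by exists 0 => dl [/ltW].
set C := \sum_i (\sum_l `|A i l|) `^ p.
have C0 : 0 <= C by apply: sumr_ge0 => i _; exact: powR_ge0.
exists (1 + C); split; first by rewrite ltr_pwDl.
move=> z _; split; last first.
  apply: le_trans (normp_pow_mulmx_le z) _; rewrite ler_wpM2r ?powR_ge0 //.
  by rewrite -/C; lra.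
apply: le_trans (normp_pow_ge0 _); rewrite mulr_le0_ge0 ?powR_ge0 //; lra.
Qed.

Lemma ripc_ge0 (k : nat) : 0 <= ripc p A k.
Proof. by apply: lb_le_inf; [case: (has_inf_RIP k)|move=> dl [/ltW]]. Qed.

(** The inequalities pass to the infimum: some admissible constant lies within e / (1 + N) of it, at
    a cost of at most e. The denominator 1 + N also covers N = 0. *)
Lemma ripcP (k : nat) (z : 'cV[R]_(n * d)) : bsparse k z ->
  (1 - ripc p A k) * norm2 z `^ p <= normp_pow p (A *m z) /\
  normp_pow p (A *m z) <= (1 + ripc p A k) * norm2 z `^ p.
Proof.
move=> zk; set N := norm2 z `^ p; set del := ripc p A k.
have N0 : 0 <= N by exact: powR_ge0.
have approx (e : R) : 0 < e -> exists2 dl, RIP k dl & dl < del + e.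
  by move=> e0; exact: inf_adherent e0 (has_inf_RIP k).
have small (e : R) : 0 < e -> 0 < e / (1 + N) /\ e / (1 + N) * N <= e.
  move=> e0; split; first by rewrite divr_gt0 // ltr_pwDl.
  by rewrite -mulrA ler_piMr ?(ltW e0) // mulrC ler_pdivrMr ?ltr_pwDl //; lra.
split; apply/ler_addgt0Pr => e /small[e' eN].
  have [dl [_ /(_ z zk)[lo _]] dle] := approx _ e'.
  apply: (@le_trans _ _ ((1 - dl) * N + e / (1 + N) * N)); last exact: lerD.
  rewrite -mulrDl ler_wpM2r //; lra.
have [dl [_ /(_ z zk)[_ up]] dle] := approx _ e'.
apply: le_trans up _; apply: (@le_trans _ _ ((1 + del) * N + e / (1 + N) * N)).
  by rewrite -mulrDl ler_wpM2r //; lra.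
by rewrite lerD2l.
Qed.

End RestrictedIsometry.

(** * Cone inequality and restricted isometry estimate for the error *)

Section Recovery.
Variables (R : realType) (m n d : nat) (p : R) (A : 'M[R]_(m, n * d)).
Hypotheses (p0 : 0 < p) (p1 : p <= 1).
Implicit Types (x h xs : 'cV[R]_(n * d)) (S T : {set 'I_n}).

(** Checked block by block, in four cases of membership in [T0] and [Tt]. Write X, Z, H for the p-th
    powers of the block norms of x, xs, xs - x: on [T0] one uses X <= Z + H, off [T0] one uses H <=
    Z + X. *)
Lemma wobj_cone (om : R) (Tt T0 : {set 'I_n}) x xs : 0 <= om -> om <= 1 ->
  wobj p om Tt xs <= wobj p om Tt x ->
  \sum_(i in ~: T0) bnorm2 (xs - x) i `^ p <=
    om * \sum_(i in T0) bnorm2 (xs - x) i `^ p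
    + (1 - om) * \sum_(i in (T0 :\: Tt) :|: (Tt :\: T0)) bnorm2 (xs - x) i `^ p
    + 2 * (om * \sum_(i in ~: T0) bnorm2 x i `^ p
           + (1 - om) * \sum_(i in ~: Tt :&: ~: T0) bnorm2 x i `^ p).
Proof.
move=> om0 om1 opt; rewrite -subr_ge0.
move: opt; rewrite -subr_ge0 => /le_trans; apply.
rewrite /wobj ![\sum_(i in _) _]big_mkcond /= mulrDr !mulr_sumr.
rewrite -sumrB -!big_split /= -sumrB; apply: ler_sum => i _.
rewrite !finset.inE.
have xsE : xs = x + (xs - x) by rewrite addrC subrK.
have xE : x = xs + - (xs - x) by rewrite opprB addrC subrK.
have := powR_bnorm2D _ _ _ _ xs (- x) i p0 p1; rewrite bnorm2N.
have := powR_bnorm2D _ _ _ _ xs (- (xs - x)) i p0 p1; rewrite bnorm2N -xE.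
set X := bnorm2 x i `^ p; set H := bnorm2 (xs - x) i `^ p; set Z := bnorm2 xs i `^ p.
by move=> XZ HZ; case: (i \in T0); case: (i \in Tt) => /=; nra.
Qed.

Lemma normp_pow_le_coord (B : R) (v : 'cV[R]_m) : 0 <= B ->
  (forall i, `|v i 0| <= B) -> normp_pow p v <= m%:R * B `^ p.
Proof.
move=> B0 vB; rewrite -[m in m%:R]card_ord mulr_natl -sumr_const.
by apply: ler_sum => i _; apply: le_powR; rewrite // ltW.
Qed.

(** A (xs - x) is the difference of two residuals, and a coordinate is at most the l2-norm. *)
Lemma residual_coord_le (x xs : 'cV[R]_(n * d)) (y : 'cV[R]_m) (eps : R) :
  norm2 (y - A *m x) <= eps -> norm2 (y - A *m xs) <= eps ->
  forall i, `|(A *m (xs - x)) i 0| <= 2 * eps.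
Proof.
move=> le1 le2 i.
have -> : A *m (xs - x) = (y - A *m x) - (y - A *m xs).
  by rewrite mulmxBr opprB [RHS]addrC addrA subrK.
rewrite mxE [X in _ + X]mxE; apply: le_trans (ler_normB _ _) _.
rewrite mulr_natl mulr2n; apply: lerD.
  exact: le_trans (abs_le_sqrt_sumsq _ _ (fun j => (y - A *m x) j 0) i) le1.
exact: le_trans (abs_le_sqrt_sumsq _ _ (fun j => (y - A *m xs) j 0) i) le2.
Qed.

(** G is the squared l2-mass of h on T0 u T1. The tail estimate is used twice with the same T1: for
    ||A h_X||_p^p with constant 1 + delta_{ak}, and for ||h_X||_2^p with constant 1. *)
Lemma rip_tail_bound (a k : nat) h T0 : (0 < a)%N -> (0 < k)%N -> (#|T0| <= k)%N ->
  let V := (a * k)%:R `^ (p / 2 - 1) * \sum_(i in ~: T0) bnorm2 h i `^ p in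
  exists G : R, [/\ 0 <= G,
    forall X Y : {set 'I_n}, X \subset ~: T0 -> (#|X| <= a * k)%N -> Y \subset T0 ->
      \sum_(i in Y :|: X) bnorm2 h i ^+ 2 <= G,
    (1 - ripc p A (a.+1 * k)) * G `^ (p / 2)
      <= normp_pow p (A *m h) + (1 + ripc p A (a * k)) * V
  & norm2 h `^ p <= G `^ (p / 2) + V].
Proof.
move=> a0 k0 T0k V; have q0 : (0 < a * k)%N by rewrite muln_gt0 a0.
have b0 i : 0 <= bnorm2 h i := bnorm2_ge0 _ _ _ h i.
have [T1 [T1S T1q top tail]] := exists_top_with_tail _ _ _ b0 p _ (~: T0) p0 q0.
have s0 (X : {set 'I_n}) : 0 <= \sum_(i in X) bnorm2 h i ^+ 2.
  by apply: sumr_ge0 => i _; exact: sqr_ge0.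
have dis : [disjoint T0 & T1] by rewrite disjoint_sym finset.disjoints_subset.
have p2 : 0 < p / 2 by rewrite divr_gt0.
have p21 : p / 2 <= 1 by rewrite ler_pdivrMr // mul1r (le_trans p1) // ler1n.
have compl : [set: 'I_n]%SET :\: (T0 :|: T1) = ~: T0 :\: T1.
  by apply/setP => i; rewrite !finset.inE negb_or andbT andbC.
exists (\sum_(i in T0 :|: T1) bnorm2 h i ^+ 2); split=> //.
- move=> X Y XS Xq YT0.
  have dYX : [disjoint Y & X].
    rewrite disjoint_sym finset.disjoints_subset; apply: fintype.subset_trans XS _.
    by rewrite finset.setCS.
  rewrite !sum_setU_disjoint //; apply: lerD; last exact: top.
  by rewrite [leRHS](big_setID Y) /= (finset.setIidPr YT0) lerDl.
- have cU : (#|T0 :|: T1| <= a.+1 * k)%N.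
    by rewrite mulSn (leq_trans (leq_card_setU _ _)) // leq_add.
  have [lo _] := ripcP _ _ _ _ _ A p0 _ _ (bsparse_restrict _ _ _ _ h _ cU).
  rewrite -norm2_restrict_powR; apply: le_trans lo _.
  (* Writing this part of h as h minus its tail lets p-subadditivity bring in A h. *)
  have -> : restrict h (T0 :|: T1) = h - restrict h (~: T0 :\: T1).
    apply/eqP; rewrite eq_sym subr_eq -compl -restrict_setID ?finset.subsetT //.
    by rewrite restrict_setT.
  rewrite mulmxBr; apply: le_trans (normp_powD _ _ _ p0 p1 _ _) _; rewrite normp_powN lerD2l.
  apply: (tail (fun X => normp_pow p (A *m restrict h X))).
  + by rewrite addr_ge0 // ripc_ge0.
  + move=> S T TS; rewrite (restrict_setID _ _ _ _ _ _ TS) mulmxDr.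
    exact: normp_powD.
  + move=> X Xq; rewrite -norm2_restrict_powR.
    by have [] := ripcP _ _ _ _ _ A p0 _ _ (bsparse_restrict _ _ _ _ h _ Xq).
- rewrite -sqr_powR_half ?norm2_ge0 // norm2_sqr.
  rewrite [X in X `^ _](_ : _ = \sum_(i in [set: 'I_n]%SET) bnorm2 h i ^+ 2); last first.
    by apply: eq_bigl => i; rewrite finset.inE.
  rewrite (big_setID (T0 :|: T1)) /= finset.setTI compl.
  apply: le_trans (powR_addl_le _ _ _ _ p2 p21 (s0 _) (s0 _)) _.
  rewrite lerD2l -[V]mul1r.
  apply: (tail (fun X => (\sum_(i in X) bnorm2 h i ^+ 2) `^ (p / 2))) => //.
  + move=> S T TS; rewrite (big_setID T) /= (finset.setIidPr TS).
    exact: powR_addl_le.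
  + by move=> X _; rewrite mul1r.
Qed.

End Recovery.

(** * Assembling the estimates and absorbing the main term *)

Lemma card_symdiff (I : finType) (S T : {set I}) :
  (#|(S :\: T) :|: (T :\: S)| + #|T :&: S| + #|T :&: S| <= #|S| + #|T|)%N.
Proof.
rewrite -(cardsID T S) -(cardsID S T) [S :&: T]finset.setIC.
have [+ _] := leq_card_setU (S :\: T) (T :\: S).
lia.
Qed.

Theorem theorem1 (R : realType) (m n d : nat) (p : R) (A : 'M[R]_(m, n * d))
    (k : nat) (om rho alpha : R) (a : nat) :
  0 < p -> p <= 1 -> (0 < k)%N ->
  0 <= om -> om <= 1 -> 0 <= rho -> 0 <= alpha ->
  let gamma := om + (1 - om) * (1 + rho - 2 * alpha * rho) `^ (1 - p / 2) in
  (1 < a)%N -> (1 - alpha) * rho <= a%:R ->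
  ripc p A (a * k) + a%:R `^ (1 - p / 2) / gamma * ripc p A (a.+1 * k)
    < a%:R `^ (1 - p / 2) / gamma - 1 ->
  exists C1 C2 : R, 0 < C1 /\ 0 < C2 /\
  forall (x : 'cV[R]_(n * d)) (e y : 'cV[R]_m) (eps : R)
         (Tt : {set 'I_n}) (xk xs : 'cV[R]_(n * d)),
    y = A *m x + e -> norm2 e <= eps ->
    best_block_approx k x xk ->
    #|Tt|%:R = rho * k%:R ->
    #|Tt :&: bsupp xk|%:R = alpha * rho * k%:R ->
    is_wlp_solution p om Tt A y eps xs ->
    norm2 (xs - x) <=
      C1 * (om * mixnorm_pow p (x - xk)
            + (1 - om) * mixnorm_pow p (restrict x (~: Tt :&: ~: bsupp xk))) `^ p^-1
         / k%:R `^ (p^-1 - 2^-1)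
      + C2 * eps.
Proof.
move=> p0 p1 k0 om0 om1 rho0 alpha0 gamma a1 arho.
set D := ripc p A (a * k); set D' := ripc p A (a.+1 * k).
set c := a%:R `^ (1 - p / 2) => cond.
have a0 : (0 < a)%N := ltnW a1.
have D0 : 0 <= D by exact: ripc_ge0.
have c0 : 0 < c by rewrite powR_gt0 // ltr0n.
set sigma := 1 + rho - 2 * alpha * rho in gamma cond.
have gamma_ge0 : 0 <= gamma.
  by rewrite addr_ge0 // mulr_ge0 ?powR_ge0 // subr_ge0.
(* If gamma were 0, division by it would yield 0 and the hypothesis would read D < -1. *)
have gamma0 : 0 < gamma.
  rewrite lt0r gamma_ge0 andbT; apply/eqP => g0.
  by move: cond; rewrite g0 invr0 mulr0 mul0r; lra.
(* [beta] is the coefficient of G^(p/2) that remains after absorption; the hypothesis times gamma /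
   c states that it is positive. *)
set beta := 1 - D' - (1 + D) * gamma / c.
have beta0 : 0 < beta.
  rewrite /beta subr_gt0 ltr_pdivrMr //.
  have -> : (1 - D') * c = gamma * (c / gamma - c / gamma * D').
    by field; rewrite gt_eqF.
  by rewrite mulrC ltr_pM2l //; lra.
(* [K1] and [K2] are the coefficients of W = k^(p/2-1) E and eps^p once g = G^(p/2) is eliminated
   from ||h||_2^p <= (1 + gamma/c) g + (2/c) W. The factor m+1 keeps [K2] positive when m = 0. *)
set K1 := (1 + gamma / c) / beta * (2 * (1 + D) / c) + 2 / c.
set K2 := (1 + gamma / c) / beta * (m.+1%:R * 2 `^ p).
have gc0 : 0 <= 1 + gamma / c by rewrite addr_ge0 // divr_ge0 // ltW.
have K1_gt0 : 0 < K1.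
  rewrite ltr_wpDl ?divr_gt0 // mulr_ge0 // divr_ge0 ?(ltW beta0) ?(ltW c0) //.
  by rewrite mulr_ge0 // addr_ge0.
have K2_gt0 : 0 < K2.
  by rewrite !mulr_gt0 ?invr_gt0 ?powR_gt0 ?ltr0n // ltr_wpDr ?divr_ge0 // ltW.
(* The factor 2^(1/p) pays for taking the root of a sum of two terms. *)
exists (2 `^ p^-1 * K1 `^ p^-1), (2 `^ p^-1 * K2 `^ p^-1).
split; first by rewrite mulr_gt0 ?powR_gt0.
split; first by rewrite mulr_gt0 ?powR_gt0.
move=> x e y eps Tt xk xs yE e_eps [T0k _] Ttk TtT0k [xs_feas xs_min].
set T0 := bsupp xk in T0k TtT0k *.
set h := xs - x.
set E := om * _ + _.
have kr : 0 < k%:R :> R by rewrite ltr0n.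
have ar : 0 < a%:R :> R by rewrite ltr0n.
have x_feas : norm2 (y - A *m x) <= eps by rewrite yE addrC addKr.
have eps0 : 0 <= eps by exact: le_trans (norm2_ge0 _ _ _) e_eps.
set P := normp_pow p (A *m h).
have P_le : P <= m.+1%:R * 2 `^ p * eps `^ p.
  apply: (@le_trans _ _ (m%:R * (2 * eps) `^ p)).
    apply: normp_pow_le_coord => //; first by rewrite mulr_ge0.
    exact: residual_coord_le x_feas xs_feas.
  by rewrite powRM // mulrA ler_wpM2r ?powR_ge0 // ler_wpM2r ?powR_ge0 // ler_nat.
have b0 i : 0 <= bnorm2 h i := bnorm2_ge0 _ _ _ h i.
have E0 : 0 <= E.
  by rewrite addr_ge0 ?mulr_ge0 ?subr_ge0 // sumr_ge0 // => i _; exact: powR_ge0.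
have [G [G0 Gtop rip hG]] := rip_tail_bound _ _ _ _ _ A p0 p1 a k h T0 a0 k0 T0k.
move: rip hG; rewrite -/D -/D' -/P.
set H := \sum_(i in ~: T0) _ => rip hG.
set U := (T0 :\: Tt) :|: (Tt :\: T0).
(* The symmetric difference has |T0| + |Tt| - 2|Tt n T0| elements, and |T0| <= k. *)
have cardU : #|U|%:R <= sigma * k%:R.
  have := card_symdiff _ T0 Tt; rewrite -(ler_nat R) !natrD TtT0k Ttk.
  have : #|T0|%:R <= k%:R :> R by rewrite ler_nat.
  by rewrite -/U /sigma; lra.
(* Its cardinality is (1 - alpha) rho k, so the lower bound on a makes this set a competitor to
   T1. *)
have cardTtD : (#|Tt :\: T0| <= a * k)%N.
  have := cardsID T0 Tt => /(congr1 (fun u : nat => u%:R : R)).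
  rewrite natrD TtT0k Ttk => e1; rewrite -(ler_nat R) natrM.
  apply: (@le_trans _ _ ((1 - alpha) * rho * k%:R)); first by lra.
  by rewrite ler_wpM2r ?ler0n.
have sub0 : finset.set0 \subset ~: T0 by rewrite finset.sub0set.
have GT0 : \sum_(i in T0) bnorm2 h i `^ p <= k%:R `^ (1 - p / 2) * G `^ (p / 2).
  apply: sum_bnorm2_powR_le => //; first by rewrite ler_nat.
  have := Gtop _ _ sub0 _ (subxx T0); rewrite finset.setU0 cards0; exact.
have GU : \sum_(i in U) bnorm2 h i `^ p <= (sigma * k%:R) `^ (1 - p / 2) * G `^ (p / 2).
  apply: sum_bnorm2_powR_le => //.
  by apply: Gtop => //; [rewrite finset.setDE finset.subsetIr|rewrite finset.subsetDl].
(* sigma k bounds a cardinality; the sign allows the power of sigma k to be split. *)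
have sigma0 : 0 <= sigma.
  by rewrite -(pmulr_lge0 _ kr) (le_trans _ cardU).
have H_le : H <= gamma * k%:R `^ (1 - p / 2) * G `^ (p / 2) + 2 * E.
  have := wobj_cone _ _ _ _ p0 p1 om Tt T0 x xs om0 om1 (xs_min _ x_feas).
  rewrite -/h -/H -/U => /le_trans; apply; apply: lerD.
    apply: (@le_trans _ _ (om * (k%:R `^ (1 - p / 2) * G `^ (p / 2)) +
       (1 - om) * ((sigma * k%:R) `^ (1 - p / 2) * G `^ (p / 2)))).
      by apply: lerD; apply: ler_wpM2l; rewrite ?subr_ge0.
    by rewrite powRM ?ler0n // le_eqVlt; apply/orP; left; apply/eqP; rewrite /gamma; ring.
  apply: (ler_wpM2l (ler0n _ 2)); rewrite /E mixnorm_pow_restrict; last by rewrite gt_eqF.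
  rewrite lerD2r; apply: (ler_wpM2l om0); exact: mixnorm_pow_sub_ge.
set g := G `^ (p / 2) in rip hG H_le.
have g0 : 0 <= g by exact: powR_ge0.
set W := k%:R `^ (p / 2 - 1) * E.
have W0 : 0 <= W := mulr_ge0 (powR_ge0 _ _) E0.
set V := _ * H in rip hG.
have V_le : V <= (gamma * g + 2 * W) / c.
  have inv (r : R) : 0 < r -> r `^ (p / 2 - 1) = (r `^ (1 - p / 2))^-1.
    by move=> r0; rewrite -powRN opprB.
  apply: (le_trans (ler_wpM2l (powR_ge0 _ _) H_le)).
  rewrite /W natrM powRM ?ler0n // !inv // -/c.
  rewrite le_eqVlt; apply/orP; left; apply/eqP; field.
  by rewrite (gt_eqF c0) gt_eqF // powR_gt0.
(* In (1 - D') g <= P + (1 + D) V, the part (1 + D) gamma g / c of the bound on (1 + D) V moves to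
   the left and leaves beta g. *)
have g_le : g <= (P + 2 * (1 + D) / c * W) / beta.
  rewrite ler_pdivlMr //.
  have : (1 + D) * V <= (1 + D) * ((gamma * g + 2 * W) / c).
    exact: ler_wpM2l (addr_ge0 ler01 D0) _ _ V_le.
  have -> : g * beta = (1 - D') * g - (1 + D) * (gamma * g / c).
    by rewrite /beta; field; rewrite gt_eqF.
  have -> : 2 * (1 + D) / c * W = (1 + D) * (2 * W / c) by field; rewrite gt_eqF.
  have -> : (1 + D) * ((gamma * g + 2 * W) / c) =
     (1 + D) * (gamma * g / c) + (1 + D) * (2 * W / c) by field; rewrite gt_eqF.
  by lra.
have hp_le : norm2 h `^ p <= K1 * W + K2 * eps `^ p.
  apply: (le_trans hG); apply: (@le_trans _ _ ((1 + gamma / c) * g + 2 / c * W)).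
    have -> : (1 + gamma / c) * g + 2 / c * W = g + (gamma * g + 2 * W) / c.
      by field; rewrite gt_eqF.
    by rewrite lerD2l.
  have g_le' : g <= (m.+1%:R * 2 `^ p * eps `^ p + 2 * (1 + D) / c * W) / beta.
    by apply: le_trans g_le _; rewrite ler_wpM2r ?invr_ge0 ?(ltW beta0) // lerD2r.
  apply: (le_trans (lerD (ler_wpM2l gc0 g_le') (lexx _))).
  rewrite le_eqVlt; apply/orP; left; apply/eqP; rewrite /K1 /K2.
  by ring.
have pi0 : 0 < p^-1 by rewrite invr_gt0.
have -> : norm2 h = (norm2 h `^ p) `^ p^-1.
  by rewrite -powRrM divff ?gt_eqF // powRr1 // norm2_ge0.
apply: (le_trans (le_powR _ _ _ _ (ltW pi0) (powR_ge0 _ _) hp_le)).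
apply: (le_trans (powRD_le_mul2 _ _ _ _ (ltW pi0) _ _)).
- exact: mulr_ge0 (ltW K1_gt0) W0.
- by rewrite mulr_ge0 ?powR_ge0 // ltW.
rewrite powRM ?(ltW K1_gt0) // powRM ?(ltW K2_gt0) ?powR_ge0 //.
rewrite -powRrM divff ?gt_eqF // powRr1 // /W powRM ?powR_ge0 //.
(* The 1/p-th power of k^(p/2-1) supplies the denominator k^(1/p-1/2). *)
rewrite -powRrM (_ : (p / 2 - 1) / p = - (p^-1 - 2^-1)); last by field; rewrite gt_eqF.
rewrite powRN le_eqVlt; apply/orP; left; apply/eqP.
by ring.
Qed.
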